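(* Let $1\le k<n$ and consider the set of nonlinear coupled differential equations on $\mathbb{R}^n$ $$\begin{aligned} \dot{x}_i &= f_i(x_1,\dots,x_n), & i&=1,\dots,k,\\ \dot{x}_i &= f_i(x_1,\dots,x_n)+v_i(u), & i&=k+1,\dots,n, \end{aligned}$$ where only the last $n-k$ equations depend explicitly on the scalar input $u=u(t)$. Write $f=(f_1,\dots,f_n)$ and let $\frac{\partial f}{\partial x}$ be its $n\times n$ Jacobian matrix. Suppose there exists a symmetric $n\times n$ matrix function $\mathbf{M}=\mathbf{M}(x_1,\dots,x_k)$, depending only on $x_1,\dots,x_k$, which is uniformly positive definite and such that $$\dot{\mathbf{M}} + \frac{\partial f}{\partial x}^T\mathbf{M} + \mathbf{M}\frac{\partial f}{\partial x}$$ is uniformly negative definite on $\mathbb{R}^n$, where $\dot{\mathbf{M}}=\sum_{i=1}^k \frac{\partial \mathbf{M}}{\partial x_i} f_i$ is the derivative of $\mathbf{M}$ along trajectories. Then the system is contracting for all possible choices of the input $u(t)$.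
   Context: All quantities ($f_i$, $v_i$, $u$, $\mathbf{M}$) are assumed real and smooth, so that all required derivatives exist and are continuous. A symmetric-matrix-valued function $\mathbf{S}$ is uniformly positive definite if there is a constant $\epsilon>0$ with $\mathbf{S}\succeq\epsilon\mathbf{I}$ at all points, and uniformly negative definite if there is a constant $\epsilon>0$ with $\mathbf{S}\preceq-\epsilon\mathbf{I}$ at all points. Given a (possibly time-varying) system $\dot{\mathbf{x}}=\mathbf{F}(\mathbf{x},t)$ and a symmetric, continuously differentiable, uniformly positive definite metric $\mathbf{M}(\mathbf{x},t)$, a region of the state space is a contraction region with respect to $\mathbf{M}$ if $\frac{\partial \mathbf{F}}{\partial \mathbf{x}}^T \mathbf{M} + \mathbf{M}\frac{\partial \mathbf{F}}{\partial \mathbf{x}} + \dot{\mathbf{M}}$ is uniformly negative definite in that region (for all $t$), where $\dot{\mathbf{M}}=\sum_i \frac{\partial \mathbf{M}}{\partial x_i}F_i+\frac{\partial \mathbf{M}}{\partial t}$. The system is contracting if there is such a metric with respect to which the whole state space is a contraction region. For a given input function $u(t)$, the system with input is regarded as the time-varying system with $F_i(\mathbf{x},t)=f_i(\mathbf{x})$ for $i\le k$ and $F_i(\mathbf{x},t)=f_i(\mathbf{x})+v_i(u(t))$ for $i>k$. *)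

(* Defs.v *)
From mathcomp Require Import all_boot all_order all_algebra.
From mathcomp Require Import all_classical all_reals all_analysis.
Import Order.TTheory GRing.Theory Num.Theory.
Import numFieldNormedType.Exports.
Set Implicit Arguments.
Unset Strict Implicit.
Unset Printing Implicit Defensive.
Local Open Scope classical_set_scope.
Local Open Scope ring_scope.

(* Points of R^n are row vectors 'rV[R]_n. *)

(* Continuously differentiable.  All uses have a finite-dimensional domain V,
   where pointwise continuity of x |-> 'd g x v for every v is the same as
   continuity of x |-> 'd g x in operator norm. *)
Definition C1 (R : realType) (V W : normedModType R) (g : V -> W) : Prop :=
  (forall x, differentiable g x) /\
  (forall v, continuous (fun x => 'd g x v)).

(* Loewner order A <= B, for symmetric A and B. *)
Definition loewner_le (R : realType) (n : nat) (A B : 'M[R]_n) : Prop :=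
  forall w : 'rV[R]_n, 0 <= (w *m (B - A) *m w^T) 0 0.

Definition unif_posdef (R : realType) (T : Type) (n : nat)
    (D : set T) (S : T -> 'M[R]_n) : Prop :=
  exists2 eps : R, 0 < eps & forall p, D p -> loewner_le eps%:M (S p).

Definition unif_negdef (R : realType) (T : Type) (n : nat)
    (D : set T) (S : T -> 'M[R]_n) : Prop :=
  exists2 eps : R, 0 < eps & forall p, D p -> loewner_le (S p) (- eps%:M).

(* The matrix of partial derivatives, with entry (i, j) equal to dg_i/dx_j.
   The library's 'J acts on row vectors from the right, 'd g x v = v *m 'J g x,
   hence the transpose. *)
Definition jac (R : realType) (n : nat) (g : 'rV[R]_n -> 'rV[R]_n)
    (x : 'rV[R]_n) : 'M[R]_n :=
  (jacobian g x)^T.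

(* J^T M + M J + dM/dt *)
Definition contraction_mx (R : realType) (n : nat) (J M Mdot : 'M[R]_n) :
    'M[R]_n :=
  J^T *m M + M *m J + Mdot.

Definition metric (R : realType) (n : nat) (M : 'rV[R]_n -> R -> 'M[R]_n) :
    Prop :=
  [/\ forall x t, (M x t)^T = M x t,
      C1 (fun p : 'rV[R]_n * R => M p.1 p.2) &
      unif_posdef setT (fun p : 'rV[R]_n * R => M p.1 p.2)].

(* Total derivative of M along the system x' = F x t. *)
Definition metric_dot (R : realType) (n : nat)
    (F : 'rV[R]_n -> R -> 'rV[R]_n) (M : 'rV[R]_n -> R -> 'M[R]_n)
    (x : 'rV[R]_n) (t : R) : 'M[R]_n :=
  \sum_(i < n) F x t 0 i *: 'D_(delta_mx 0 i) (fun y => M y t) x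
  + (M x)^`()%classic t.

(* Differentiability of F in x is part of the definition because the library
   derivatives are total functions, with an arbitrary value where no derivative
   exists. *)
Definition contraction_region (R : realType) (n : nat)
    (F : 'rV[R]_n -> R -> 'rV[R]_n) (M : 'rV[R]_n -> R -> 'M[R]_n)
    (D : set 'rV[R]_n) : Prop :=
  (forall x t, D x -> differentiable (fun y => F y t) x) /\
  unif_negdef [set p : 'rV[R]_n * R | D p.1]
    (fun p => contraction_mx (jac (fun y => F y p.2) p.1) (M p.1 p.2)
                (metric_dot F M p.1 p.2)).

Definition contracting (R : realType) (n : nat)
    (F : 'rV[R]_n -> R -> 'rV[R]_n) : Prop :=
  exists2 M : 'rV[R]_n -> R -> 'M[R]_n,
    metric M & contraction_region F M setT.

(* State of dimension k + m; the input enters the last m equations only. *)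
Definition with_input (R : realType) (k m : nat)
    (f : 'rV[R]_(k + m) -> 'rV[R]_(k + m)) (v : R -> 'rV[R]_m) (u : R -> R)
    (x : 'rV[R]_(k + m)) (t : R) : 'rV[R]_(k + m) :=
  f x + row_mx 0 (v (u t)).

(* Derivative along x' = f x of a matrix function M of the first k coordinates
   lsubmx x. *)
Definition partial_metric_dot (R : realType) (k m : nat)
    (f : 'rV[R]_(k + m) -> 'rV[R]_(k + m))
    (M : 'rV[R]_k -> 'M[R]_(k + m)) (x : 'rV[R]_(k + m)) : 'M[R]_(k + m) :=
  \sum_(i < k) f x 0 (lshift m i) *: 'D_(delta_mx 0 i) M (lsubmx x).

(* Main.v *)
(** The lift [N(x, t) = M (x_1, ..., x_k)] of the given metric works for every
    input.  At fixed [t] the input only adds a constant to the vector field, so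
    the Jacobian is unchanged; and it enters only the equations along whose
    coordinates [N] has zero partial derivative, so the derivative of [N] along
    trajectories is unchanged as well. *)
Require Import Defs.
From mathcomp Require Import all_boot all_order all_algebra.
From mathcomp Require Import all_classical all_reals all_analysis.
Import Order.TTheory GRing.Theory Num.Theory.
Import numFieldNormedType.Exports.
Local Open Scope classical_set_scope.
Local Open Scope ring_scope.

(** By the chain rule the differential of [g \o l] at [y] in direction [v] is ['d g (l y) (l v)].
    The direction [l v] does not vary with [y], so directional continuity carries over from [g]. *)
Lemma C1_comp_linear (R : realType) (U V W : normedModType R)
    (l : {linear U -> V}) (g : V -> W) :
  continuous l -> C1 g -> C1 (g \o l).
Proof.
move=> cl [dg cdg]; have dl x : differentiable l x by exact: linear_differentiable.
split=> [x|v x]; first exact: differentiable_comp.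
rewrite (_ : (fun y => _) = (fun z => 'd g z (l v)) \o l).
  by apply: continuous_comp; [exact: cl | exact: cdg].
by apply/funext => y; rewrite diff_comp//= diff_lin.
Qed.

(** Linearity makes the two difference quotients the same function of [h], so their limits agree,
    default values included. *)
Lemma derive_comp_linear (R : realType) (U V W : normedModType R)
    (l : {linear U -> V}) (g : V -> W) (x v : U) :
  'D_v (g \o l) x = 'D_(l v) g (l x).
Proof.
rewrite /derive (_ : (fun h => _) =
  fun h => h^-1 *: ((g \o shift (l x)) (h *: l v) - g (l x)))//.
by apply/funext => h /=; rewrite linearP.
Qed.

Lemma derive_lsubmx (R : realType) (k m : nat) (W : normedModType R)
    (g : 'rV[R]_k -> W) (x v : 'rV[R]_(k + m)) :
  'D_v (fun y : 'rV[R]_(k + m) => g (lsubmx y)) x = 'D_(lsubmx v) g (lsubmx x).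
Proof.
pose l : {linear 'rV[R]_(k + m) -> 'rV[R]_k} := lsubmx.
exact (@derive_comp_linear R _ _ _ l g x v).
Qed.

(** Serves the last [m] coordinate directions, which [lsubmx] sends to [0]. *)
Lemma derive_dir0 (R : realType) (V W : normedModType R) (g : V -> W) (x : V) :
  'D_0 g x = 0.
Proof.
rewrite /derive (_ : (fun h => _) = cst 0) ?lim_cst//.
by apply/funext => h /=; rewrite scaler0 add0r subrr scaler0.
Qed.

Lemma lsubmx_delta_lshift (R : realType) (k m : nat) (i : 'I_k) :
  lsubmx (delta_mx 0 (lshift m i) : 'rV[R]_(k + m)) = delta_mx 0 i.
Proof. by apply/rowP => j; rewrite !mxE eq_lshift. Qed.

Lemma lsubmx_delta_rshift (R : realType) (k m : nat) (i : 'I_m) :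
  lsubmx (delta_mx 0 (rshift k i) : 'rV[R]_(k + m)) = 0.
Proof. by apply/rowP => j; rewrite !mxE eq_lrshift andbF. Qed.

Lemma metric_lsubmx (R : realType) (k m : nat) (M : 'rV[R]_k -> 'M[R]_(k + m)) :
  (forall y, (M y)^T = M y) -> C1 M -> unif_posdef setT M ->
  metric (fun (x : 'rV[R]_(k + m)) (_ : R) => M (lsubmx x)).
Proof.
move=> symM C1M [e e0 posM]; split=> //; last by exists e => // p _; exact: posM.
(* A metric must be C1 jointly in [(x, t)]; the lift is [M] after this linear projection. *)
pose l : {linear ('rV[R]_(k + m) * R)%type -> 'rV[R]_k} := lsubmx \o fst.
apply: (@C1_comp_linear _ _ _ _ l) => // p.
by apply: continuous_comp; [exact: cvg_fst | exact: continuous_lsubmx].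
Qed.

Lemma diff_addr_cst (R : realType) (V W : normedModType R) (g : V -> W)
    (c : W) (x : V) :
  differentiable g x -> 'd (fun y => g y + c) x = 'd g x :> (V -> W).
Proof.
move=> dg; apply: etrans (diffD dg (differentiable_cst c x)) _.
apply/funext => w; apply: etrans _ (addr0 _).
exact (congr1 (fun h : V -> W => 'd g x w + h w) (diff_cst c x)).
Qed.

Lemma jac_addr_cst (R : realType) (n : nat) (g : 'rV[R]_n -> 'rV[R]_n)
    (c x : 'rV[R]_n) :
  differentiable g x -> jac (fun y => g y + c) x = jac g x.
Proof.
(* The Jacobian is [lin1_mx] of the differential, which sees only the underlying function. *)
move=> dg; exact (congr1 (fun h : 'rV[R]_n -> 'rV[R]_n => (lin1_mx h)^T)
  (@diff_addr_cst R 'rV[R]_n 'rV[R]_n g c x dg)).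
Qed.

Lemma metric_dot_with_input (R : realType) (k m : nat)
    (f : 'rV[R]_(k + m) -> 'rV[R]_(k + m)) (v : R -> 'rV[R]_m) (u : R -> R)
    (M : 'rV[R]_k -> 'M[R]_(k + m)) (x : 'rV[R]_(k + m)) (t : R) :
  metric_dot (with_input f v u) (fun y _ => M (lsubmx y)) x t =
  partial_metric_dot f M x.
Proof.
rewrite /metric_dot derive1_cst addr0 big_split_ord/=.
(* The terms with input have zero partial derivative; the first [k] terms have a zero input
   entry. *)
rewrite [X in _ + X]big1 ?addr0 => [|i _].
  apply: eq_bigr => i _; rewrite derive_lsubmx.
  by rewrite lsubmx_delta_lshift /with_input mxE row_mxEl mxE addr0.
by rewrite derive_lsubmx lsubmx_delta_rshift derive_dir0 scaler0.
Qed.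

Theorem theorem2 (R : realType) (k m : nat) (hk : (1 <= k)%N) (hm : (1 <= m)%N)
    (f : 'rV[R]_(k + m) -> 'rV[R]_(k + m)) (v : R -> 'rV[R]_m)
    (hf : C1 f) (hv : C1 v)
    (M : 'rV[R]_k -> 'M[R]_(k + m))
    (hMsym : forall y, (M y)^T = M y)
    (hMC1 : C1 M)
    (hMpos : unif_posdef setT M)
    (hneg : unif_negdef setT (fun x : 'rV[R]_(k + m) =>
       contraction_mx (jac f x) (M (lsubmx x)) (partial_metric_dot f M x))) :
  forall u : R -> R, C1 u -> contracting (with_input f v u).
Proof.
move=> u _; have [df _] := hf.
exists (fun x _ => M (lsubmx x)); first exact: metric_lsubmx.
split=> [x t _|].
  by apply: differentiableD => //; exact: differentiable_cst.
(* The matrix at [(x, t)] equals the given one at [x], so the same [e] serves all [t]. *)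
have [e e0 neg] := hneg; exists e => // -[x t] _.
by rewrite /= jac_addr_cst// metric_dot_with_input; exact: neg.
Qed.
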